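(* Assume the standing setting with Assumptions (A1) and (A2). Let $\alpha\in(0,1)$, $\mu\in\mathfrak F$, $X\sim\mu$. Let $\sigma$ be a (random) permutation of $\{1,\dots,m\}$ with $p_{\sigma(1)}\le\dots\le p_{\sigma(m)}$, $p_{(k)}=p_{\sigma(k)}$, and $R_k=\{\sigma(1),\dots,\sigma(k)\}$. Each of the following three reference families $(R_k,\zeta_k)_{1\le k\le m}$ satisfies $\mathrm{JER}_\mu\le\alpha$: 1. $\zeta_k=\mathbf 1\{p_{(k)}>0\}\big\lfloor mp_{(k)}+\sqrt{\tfrac m2\log\tfrac1\alpha}\big\rfloor\wedge k$; 2. $\zeta_k=0$ if $p_{(k)}=0$ and otherwise $\zeta_k=\Big\lfloor mp_{(k)}\,h^{-1}\Big(\frac{2\log(\kappa/\alpha)+4\log(1+\log_2(1/p_{(k)}))}{mp_{(k)}}\Big)\Big\rfloor\wedge k$; 3. $\zeta_k=\mathbf 1\{p_{(k)}>0\}\big(\lceil mp_{(k)}/\alpha\rceil-1\big)\wedge k$.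
   Context: Standing setting: data $X$ with law $\mu$ in a model $\mathfrak F$; null hypotheses $H_1,\dots,H_m\subseteq\mathfrak F$; $\mathcal H_0(\mu)=\{i:\mu\in H_i\}$; $p$-values $p_i=p_i(X)\in[0,1]$. (A1): for $i\in\mathcal H_0(\mu)$, $\mathbb P_\mu(p_i\le x)\le 0\vee(x\wedge1)$ for all $x$. (A2): $(p_i)_{i\in\mathcal H_0(\mu)}$ mutually independent. A reference family is a finite family $(R_k,\zeta_k)_{k\in\mathcal K}$ of (data-dependent) subsets $R_k\subseteq\{1,\dots,m\}$ and integers $\zeta_k$; its joint error rate is $\mathrm{JER}_\mu=\mathbb P_\mu(\exists k\in\mathcal K:\ |R_k\cap\mathcal H_0(\mu)|>\zeta_k)$. $\kappa=\pi^2/6$, $h(x)=x(\log x-1)+1$ on $(1,\infty)$, $h^{-1}$ its inverse $(0,\infty)\to(1,\infty)$. *)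

(* Defs.v *)
From HB Require Import structures.
From mathcomp Require Import all_boot all_order all_algebra.
From mathcomp Require Import all_classical all_reals perm.
From mathcomp Require Import ereal topology normedtype sequences exp trigo measure lebesgue_measure probability.
Set Implicit Arguments. Unset Strict Implicit. Unset Printing Implicit Defensive.
Import Order.TTheory GRing.Theory Num.Theory.
Local Open Scope classical_set_scope.
Local Open Scope ring_scope.

Section Defs.
Context {R : realType}.

Definition h_fun (x : R) : R := x * (ln x - 1) + 1.

(* h^{-1} : (0, +oo) -> (1, +oo), the inverse of h restricted to (1, +oo);
   for t > 0 the set below is a singleton. *)
Definition h_inv (t : R) : R := xget 1 [set y : R | 1 < y /\ h_fun y = t].

Definition kappa : R := pi ^+ 2 / 6%:R.

Definition log2 (x : R) : R := ln x / ln 2.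

(* The three choices of zeta_k, as a function of m, alpha, q = p_(k)
   and the (1-based) index k. *)
Definition zeta1 (m : nat) (alpha q : R) (k : nat) : int :=
  Num.min (if 0 < q then Num.floor (m%:R * q + Num.sqrt (m%:R / 2 * ln (1 / alpha))) else 0%R)
          (k%:Z).

Definition zeta2 (m : nat) (alpha q : R) (k : nat) : int :=
  if q == 0 then 0%R else
  Num.min (Num.floor (m%:R * q *
             h_inv ((2 * ln (kappa / alpha) + 4 * ln (1 + log2 (1 / q))) / (m%:R * q))))
          (k%:Z).

Definition zeta3 (m : nat) (alpha q : R) (k : nat) : int :=
  Num.min (if 0 < q then Num.ceil (m%:R * q / alpha) - 1 else 0%R) (k%:Z).

End Defs.

Definition mutually_independent {d} {T : measurableType d} {R : realType}
  (P : probability T R) {m : nat} (A : {set 'I_m}) (X : 'I_m -> T -> R) : Prop :=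
  forall (J : {set 'I_m}) (B : 'I_m -> set R),
    J \subset A -> (forall j, j \in J -> measurable (B j)) ->
    P (\bigcap_(j in [set j | j \in J]) (X j @^-1` B j)) =
    (\prod_(j in J) P (X j @^-1` B j))%E.

(* Reference family R_k = {sigma(1), ..., sigma(k)}; with 0-based ordinals,
   index k : 'I_m stands for k+1 and R_{k+1} = {sigma(j) | j <= k}. *)
Definition Rfam {m : nat} (sigma : {perm 'I_m}) (k : 'I_m) : {set 'I_m} :=
  [set sigma j | j : 'I_m & (j <= k)%N].

(* Joint error rate of the reference family (R_k, zeta_k)_k, where
   zeta t k is the (data-dependent) bound attached to index k : 'I_m (k+1). *)
Definition JER {d} {T : measurableType d} {R : realType} (P : probability T R)
  {m : nat} (H0 : {set 'I_m}) (Rf : T -> 'I_m -> {set 'I_m})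
  (zeta : T -> 'I_m -> int) : \bar R :=
  P [set t | exists k : 'I_m, (zeta t k < (#|Rf t k :&: H0|)%:Z)%R].

(* Main.v *)
(* Write [N t] for the number of null p-values that are at most [t]. An error at level
   [q = p_(k)] means that [N q] lies above an explicit boundary at [q], and, since [N]
   is nondecreasing, this forces [N (s_j) >= j] for one of finitely many thresholds
   [s_j]. For uniform p-values [t |-> (1 + c / t) ^+ N t] is a martingale when [t] runs
   from [1] down to [0]; stopping it at the first crossing bounds the crossing
   probability by [((1 + c) ^+ m - 1) / (L - 1)] as soon as [L <= (1 + c / s_j) ^+ j]
   for all [j]. Replacing [t] by the distribution functions of the p-values makes the
   argument work without uniformity.

   The three bounds are three choices of [c]:
   - for [zeta1] the Dvoretzky-Kiefer-Wolfowitz-Massart inequality follows, for every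
     deviation [e] in [0, 1[, from [c = 2 e (3 + e) / (3 (1 - e))];
   - for [zeta2], [c = s (x - 1)] gives the bound [exp (- m s h(x))] for the event that
     [N t >= x m t] for some [t >= s], which is summed over the dyadic values of [s]
     with [sum_j 1 / j ^ 2 <= kappa];
   - for [zeta3], [c] tends to [0], which is Simes' inequality. *)
Require Import Defs.
From HB Require Import structures.
From mathcomp Require Import all_boot all_order all_algebra.
From mathcomp Require Import all_classical all_reals perm.
From mathcomp Require Import ereal topology normedtype sequences exp trigo measure lebesgue_measure probability.
From mathcomp Require Import derive realfun measurable_realfun ring lra.
Set Implicit Arguments. Unset Strict Implicit. Unset Printing Implicit Defensive.
Import Order.TTheory GRing.Theory Num.Theory.
Import numFieldNormedType.Exports.
Local Open Scope classical_set_scope.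
Local Open Scope ring_scope.

(** * A deviation inequality for the exponent of the Dvoretzky-Kiefer-Wolfowitz bound *)

Section RealCalculus.
Context {R : realType}.
Implicit Types (f g : R -> R) (a b x e s : R).

Lemma derive_ge0_le f (df : R -> R) a b : a <= b ->
  (forall x, a <= x <= b -> is_derive x 1 f (df x)) ->
  (forall x, a <= x <= b -> 0 <= df x) -> f a <= f b.
Proof.
move=> ab fE df0.
have fE' x : x \in `[a, b] -> is_derive x 1 f (df x) by rewrite in_itv/=; exact: fE.
have fE'' x : x \in `]a, b[ -> is_derive x 1 f (df x).
  by move=> xab; apply: fE'; exact: subset_itv_oo_cc xab.
have cf : {within `[a, b], continuous f}.
  by apply: derivable_within_continuous => x /fE' dfx; exact: ex_derive.
have [c] := MVT_segment ab fE'' cf.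
rewrite in_itv/= => cab fba.
by rewrite -subr_ge0 fba mulr_ge0 ?subr_ge0// df0.
Qed.

Lemma is_derive_lnf f x df : is_derive x 1 f df -> 0 < f x ->
  is_derive x 1 (fun y => ln (f y)) (df / f x).
Proof.
move=> dfx fx0; have := is_derive1_ln fx0 => dln.
by apply: is_derive_eq; rewrite mulrC.
Qed.

Lemma is_derive_divf f g x df dg :
  is_derive x 1 f df -> is_derive x 1 g dg -> g x != 0 ->
  is_derive x 1 (fun y => f y / g y) ((df * g x - f x * dg) / g x ^+ 2).
Proof.
move=> dfx dgx gx0.
have dV := is_deriveV gx0.
apply: is_derive_eq => /=.
rewrite /GRing.scale/=; field.
exact: gx0.
Qed.

(* The expansion [2 e + (8 / 3) e ^+ 2 + ...] is forced: with another second-order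
   coefficient [dkw_exponent] fails for small [e]. *)
Definition dkw_c e : R := 2 * e * (3 + e) / (3 * (1 - e)).
Definition dkw_dc e : R := 2 * (3 - e) * (1 + e) / (3 * (1 - e) ^+ 2).

Lemma is_derive_dkw_c e : e < 1 -> is_derive e 1 dkw_c (dkw_dc e).
Proof.
move=> e1; have e10 : 1 - e != 0 by rewrite subr_eq0 gt_eqF.
have d1 : is_derive e 1 (fun e => 2 * e * (3 + e)) (6 + 4 * e).
  by apply: is_derive_eq; rewrite /GRing.scale/=; ring.
have d2 : is_derive e 1 (fun e => 3 * (1 - e)) (-3).
  by apply: is_derive_eq; rewrite /GRing.scale/=; ring.
have h3 : 3 * (1 - e) != 0 by rewrite mulf_neq0.
apply: (is_derive_eq (is_derive_divf d1 d2 _)) => //.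
by rewrite /dkw_dc; field.
Qed.

Lemma dkw_c_ge0 e : 0 <= e < 1 -> 0 <= dkw_c e.
Proof.
move=> /andP[e0 e1]; rewrite /dkw_c divr_ge0//; last lra.
by rewrite mulr_ge0//; lra.
Qed.

(** With [c = dkw_c e] and [c' = dkw_dc e], [dkw_A] is the rational solution [A] of
    [A * c = c' * (c - e)], the relation that makes the terms in [s] cancel in [dkw_exponent];
    [dkw_phi] is [c' * c / (1 + c)]. *)
Definition dkw_A e : R :=
  (3 - e) * (1 + e) * (3 + 5 * e) / (3 * (1 - e) ^+ 2 * (3 + e)).
Definition dkw_phi e : R :=
  4 * e * (3 - e) * (1 + e) * (3 + e) / (3 * (1 - e) ^+ 2 * (3 + 3 * e + 2 * e ^+ 2)).

Lemma dkw_A_gt0 e : 0 <= e < 1 -> 0 < dkw_A e.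
Proof.
move=> /andP[e0 e1]; rewrite /dkw_A divr_gt0//.
  by rewrite !mulr_gt0//; lra.
by rewrite !mulr_gt0// ?exprn_gt0//; lra.
Qed.

Lemma dkw_AE e : 0 <= e < 1 -> dkw_A e * dkw_c e = dkw_dc e * (dkw_c e - e).
Proof.
move=> /andP[e0 e1]; rewrite /dkw_A /dkw_c /dkw_dc.
by field; apply/andP; split; apply: lt0r_neq0; lra.
Qed.

Lemma dkw_phiE e : 0 <= e < 1 ->
  dkw_phi e = dkw_dc e - dkw_dc e / (1 + dkw_c e).
Proof.
move=> /andP[e0 e1]; rewrite /dkw_phi /dkw_c /dkw_dc.
have e2 : 0 <= e ^+ 2 by exact: sqr_ge0.
field; repeat (apply/andP; split); apply: lt0r_neq0; nra.
Qed.

(** This is the [s]-free lower bound for the derivative studied in [dkw_exponent]. It vanishes at 0,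
    and its own derivative is the rational function [16 * N / D]. *)
Lemma dkw_d_ge0 e : 0 <= e < 1 ->
  0 <= ln (dkw_A e) + 1 - dkw_A e + dkw_phi e - 4 * e.
Proof.
move=> /andP[e0 e1].
pose N x := x ^+ 2 * (243 + 684 * x + 1068 * x ^+ 2 + 1185 * x ^+ 3
  + 764 * x ^+ 4 + 220 * x ^+ 5 - 30 * x ^+ 6 - 33 * x ^+ 7 - 5 * x ^+ 8) : R.
pose D x := (1 - x) * (3 - x) * (1 + x) * (3 + 5 * x) * (3 + x) ^+ 2 *
  (3 + 3 * x + 2 * x ^+ 2) ^+ 2 : R.
pose F x := ln (dkw_A x) + 1 - dkw_A x + dkw_phi x - 4 * x.
have -> : ln (dkw_A e) + 1 - dkw_A e + dkw_phi e - 4 * e = F e by [].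
have <- : F 0 = 0.
  have A0 : dkw_A 0 = 1 by rewrite /dkw_A; field.
  have p0 : dkw_phi 0 = 0 by rewrite /dkw_phi; field.
  by rewrite /F A0 p0 ln1; ring.
apply: (@derive_ge0_le F (fun x => 16 * N x / D x)) => // x /andP[x0 xe].
  have x1 : x < 1 by exact: le_lt_trans e1.
  have x01 : 0 <= x < 1 by rewrite x0.
  have x2 : 0 <= x ^+ 2 by exact: sqr_ge0.
  have q0 : 0 < 3 + 3 * x + 2 * x ^+ 2 by lra.
  have hx1 : 0 < (1 - x) ^+ 2 by rewrite exprn_gt0// subr_gt0.
  have d1 : is_derive x 1 (fun e => (3 - e) * (1 + e) * (3 + 5 * e))
      (21 + 14 * x - 15 * x ^+ 2).
    by apply: is_derive_eq; rewrite /GRing.scale/=; ring.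
  have d2 : is_derive x 1 (fun e => 3 * (1 - e) ^+ 2 * (3 + e))
      (3 * (1 - x) * (- 5 - 3 * x)).
    by apply: is_derive_eq; rewrite /GRing.scale/=; ring.
  have d3 : is_derive x 1 (fun e => 4 * e * (3 - e) * (1 + e) * (3 + e))
      (4 * (9 + 18 * x - 3 * x ^+ 2 - 4 * x ^+ 3)).
    by apply: is_derive_eq; rewrite /GRing.scale/=; ring.
  have d4 : is_derive x 1 (fun e => 3 * (1 - e) ^+ 2 * (3 + 3 * e + 2 * e ^+ 2))
      (3 * (- 2 * (1 - x) * (3 + 3 * x + 2 * x ^+ 2) + (1 - x) ^+ 2 * (3 + 4 * x))).
    by apply: is_derive_eq; rewrite /GRing.scale/=; ring.
  have p30 : 0 < 3 + x by lra.
  have dA0 : 3 * (1 - x) ^+ 2 * (3 + x) != 0.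
    by apply: lt0r_neq0; apply: mulr_gt0 => //; apply: mulr_gt0.
  have dP0 : 3 * (1 - x) ^+ 2 * (3 + 3 * x + 2 * x ^+ 2) != 0.
    by apply: lt0r_neq0; apply: mulr_gt0 => //; apply: mulr_gt0.
  have dA : is_derive x 1 dkw_A _ := is_derive_divf d1 d2 dA0.
  have dP : is_derive x 1 dkw_phi _ := is_derive_divf d3 d4 dP0.
  have dL := is_derive_lnf dA (dkw_A_gt0 x01).
  apply: is_derive_eq; rewrite /GRing.scale/= /N /D /dkw_A.
  by field; repeat (apply/andP; split); apply: lt0r_neq0; lra.
have x1 : x < 1 by exact: le_lt_trans e1.
have x2 : 0 <= x ^+ 2 by exact: sqr_ge0.
have N0 : 0 <= N x.
  rewrite /N; apply: mulr_ge0; first exact: sqr_ge0.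
  (* All powers lie in [0, 1], so the negative coefficients, 68 in total, are absorbed by the
     constant 243. *)
  have xn n : 0 <= x ^+ n <= 1 by rewrite exprn_ge0//= exprn_ile1// ltW.
  move: (xn 2%N) (xn 3%N) (xn 4%N) (xn 5%N) (xn 6%N) (xn 7%N) (xn 8%N).
  move: (x ^+ 2) (x ^+ 3) (x ^+ 4) (x ^+ 5) (x ^+ 6) (x ^+ 7) (x ^+ 8).
  by clear -x0; move=> ? ? ? ? ? ? ?; lra.
have D0 : 0 <= D x.
  rewrite /D; repeat apply: mulr_ge0; try exact: sqr_ge0; by clear -x0 x1 x2; lra.
by apply: divr_ge0 => //; apply: mulr_ge0.
Qed.

(** Multiplied by [m], with [j = m (s + e)], this is the logarithm of the requirement
    [L <= (1 + c / s) ^+ j] for [L = (1 + c) ^+ m * expR (2 m e ^+ 2)]. Both sides vanish at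
    [e = 0], and the derivative in [e] of their difference is nonnegative. *)
Lemma dkw_exponent e s : 0 <= e < 1 -> 0 < s ->
  ln (1 + dkw_c e) + 2 * e ^+ 2 <= (s + e) * ln (1 + dkw_c e / s).
Proof.
move=> /andP[e0 e1] s0.
pose G x := (s + x) * ln (1 + dkw_c x / s) - ln (1 + dkw_c x) - 2 * x ^+ 2.
suff : 0 <= G e by rewrite /G; lra.
have <- : G 0 = 0.
  have c0 : dkw_c 0 = 0 by rewrite /dkw_c; field.
  by rewrite /G c0 mul0r !addr0 ln1; ring.
pose dG x := ln (1 + dkw_c x / s) + (s + x) * (dkw_dc x / s / (1 + dkw_c x / s))
             - dkw_dc x / (1 + dkw_c x) - 4 * x.
apply: (@derive_ge0_le G dG) => // x /andP[x0 xe];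
  have x1 : x < 1 by [exact: le_lt_trans e1];
  have x01 : 0 <= x < 1 by [rewrite x0];
  have c0 := dkw_c_ge0 x01;
  have cs0 : 0 < 1 + dkw_c x / s by [rewrite ltr_pwDl// divr_ge0// ltW].
  have dc := is_derive_dkw_c x1.
  have d1 : is_derive x 1 (fun x => 1 + dkw_c x) (dkw_dc x).
    by apply: is_derive_eq; rewrite /GRing.scale/=; ring.
  have d2 : is_derive x 1 (fun x => 1 + dkw_c x / s) (dkw_dc x / s).
    by apply: is_derive_eq; rewrite /GRing.scale/=; ring.
  have c10 : 0 < 1 + dkw_c x by rewrite ltr_pwDl.
  have dl1 := is_derive_lnf d1 c10.
  have dl2 := is_derive_lnf d2 cs0.
  by apply: is_derive_eq; rewrite /GRing.scale/= /dG; ring.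
(* [- ln v >= ln A + 1 - A v] at [v = s / (s + c)] makes the bound independent of [s] *)
have A0 := dkw_A_gt0 x01.
have sc0 : 0 < s + dkw_c x by rewrite ltr_pwDl.
have vE : ln (1 + dkw_c x / s) >= ln (dkw_A x) + 1 - dkw_A x * (s / (s + dkw_c x)).
  have v0 : 0 < s / (s + dkw_c x) by rewrite divr_gt0.
  have -> : 1 + dkw_c x / s = (s / (s + dkw_c x))^-1 by field; rewrite !lt0r_neq0.
  rewrite lnV ?posrE//.
  have : ln (1 + (dkw_A x * (s / (s + dkw_c x)) - 1)) <= dkw_A x * (s / (s + dkw_c x)) - 1.
    by apply: le_ln1Dx; rewrite ltrBrDr addNr mulr_gt0.
  by rewrite addrC subrK lnM ?posrE//; lra.
have := dkw_d_ge0 x01; rewrite (dkw_phiE x01) => d0.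
suff E : - dkw_A x * (s / (s + dkw_c x)) + (s + x) * (dkw_dc x / s / (1 + dkw_c x / s))
    = dkw_dc x - dkw_A x by rewrite /dG; lra.
have -> : (s + x) * (dkw_dc x / s / (1 + dkw_c x / s)) =
  dkw_dc x - dkw_dc x * (dkw_c x - x) / (s + dkw_c x).
  by field; rewrite !lt0r_neq0.
rewrite -(dkw_AE x01).
by field; rewrite !lt0r_neq0.
Qed.

End RealCalculus.

(** * The sum of inverse squares and the function h *)

Section RealFacts.
Context {R : realType}.
Implicit Types (x y c s t : R).

Lemma sin_le_id x : 0 <= x -> sin x <= x.
Proof.
move=> x0; rewrite -subr_ge0.
have -> : 0 = (fun y : R => y - sin y) 0 by rewrite /= sin0 subr0.
apply: (@derive_ge0_le R (fun y => y - sin y) (fun y => 1 - cos y)) => // y _.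
Qed.

(** Double-angle formula for the sine, with [cos (x / 2)] written as the sine of the complementary
    angle so that the identity can be iterated. *)
Lemma inv_sin2_half x : 0 < x < pi ->
  (sin x ^+ 2)^-1 = ((sin (x / 2) ^+ 2)^-1 + (sin (pi / 2 - x / 2) ^+ 2)^-1) / 4.
Proof.
move=> /andP[x0 xpi].
have x2 : 0 < x / 2 < pi / 2 by apply/andP; split; lra.
have s0 : sin (x / 2) != 0 by rewrite gt_eqF// sin_gt0_pihalf.
have c0 : cos (x / 2) != 0.
  by rewrite gt_eqF// cos_gt0_pihalf//; move/andP: x2 => [a b]; apply/andP; split; lra.
rewrite sinB sin_pihalf cos_pihalf mul0r subr0 mul1r.
have -> : sin x = 2 * (cos (x / 2) * sin (x / 2)).
  by rewrite {1}(_ : x = x / 2 *+ 2) ?sin_mulr2n ?mulr_natl// -mulr_natr; field.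
have := cos2Dsin2 (x / 2).
move: s0 c0; move: (sin _) (cos _) => a b a0 b0 ab.
have -> : (a ^+ 2)^-1 + (b ^+ 2)^-1 = (b ^+ 2 + a ^+ 2) / (a ^+ 2 * b ^+ 2).
  by field; rewrite ?a0 ?b0.
by rewrite ab; field; rewrite ?a0 ?b0.
Qed.

Lemma sum_inv_sin2 n :
  \sum_(k < 2 ^ n) (sin ((2 * k + 1)%:R * pi / (4 * 2 ^+ n)) ^+ 2)^-1 = 2 * 4 ^+ n :> R.
Proof.
elim: n => [|n ih].
  rewrite expn0 big_ord_recl big_ord0 addr0 /= muln0 add0n !expr0 !mulr1 mul1r.
  have := @inv_sin2_half (pi / 2); rewrite sin_pihalf expr1n invr1.
  have -> : pi / 2 - pi / 2 / 2 = pi / 4 :> R by field.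
  have -> : pi / 2 / 2 = pi / 4 :> R by field.
  have pi20 : 0 < (pi : R) / 2 < pi.
    by have := pi_gt0 R => ?; apply/andP; split; lra.
  by move=> /(_ pi20); lra.
pose f x : R := (sin x ^+ 2)^-1.
have N0 : 0 < 2 ^+ n :> R by rewrite exprn_gt0.
have -> : 2 * 4 ^+ n.+1 = 4 * (2 * 4 ^+ n) :> R by rewrite exprS; ring.
rewrite -ih mulr_sumr expnS mul2n -addnn big_split_ord/=.
(* Reversing the upper half pairs each angle with its complement to [pi / 2]; each pair then
   collapses to one angle of level [n]. *)
rewrite [X in _ + X](reindex_inj rev_ord_inj)/= -big_split/=.
apply: eq_bigr => k _.
rewrite (@inv_sin2_half ((2 * k + 1)%:R * pi / (4 * 2 ^+ n))).
  rewrite [RHS]mulrC divfK//; congr ((sin _ ^+ _)^-1 + (sin _ ^+ _)^-1).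
    by rewrite exprS; field; rewrite gt_eqF.
  have -> : (2 * (2 ^ n + (2 ^ n - k.+1)) + 1)%:R = 4 * 2 ^+ n - (2 * k + 1)%:R :> R.
    have kn : (k < 2 ^ n)%N by [].
    rewrite natrD natrM natrD natrB// natrX natrD natrM -natr1.
    by ring.
  by rewrite exprS; field; rewrite gt_eqF.
have kn : (2 * k + 1)%:R < 2 * 2 ^+ n :> R.
  rewrite -natrX -natrM ltr_nat (leq_trans _ (leq_mul (leqnn 2) (ltn_ord k)))//.
  by rewrite mulnS add2n addn1.
have k0 : 0 < (2 * k + 1)%:R :> R by rewrite ltr0n addn1.
rewrite divr_gt0 ?mulr_gt0 ?pi_gt0//=.
rewrite ltr_pdivrMr ?mulr_gt0// mulrC ltr_pM2l ?pi_gt0//; lra.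
Qed.

(** Extend the sum to [2 ^ n] terms and compare it with [sum_inv_sin2] through
    [1 / x ^ 2 <= 1 / sin x ^ 2] at each angle [x]. *)
Lemma sum_inv_odd2_le n : \sum_(k < n) ((2 * k + 1)%:R ^+ 2)^-1 <= pi ^+ 2 / 8 :> R.
Proof.
set f := fun k : nat => ((2 * k + 1)%:R ^+ 2)^-1 : R.
have n2 : (n <= 2 ^ n)%N by rewrite ltnW// ltn_expl.
apply: (@le_trans _ _ (\sum_(k < 2 ^ n) f k)).
  rewrite -!(big_mkord xpredT f) [leRHS](big_cat_nat (leq0n n) n2)//= lerDl.
  by apply: sumr_ge0 => k _; rewrite invr_ge0 sqr_ge0.
have N0 : 0 < 2 ^+ n :> R by rewrite exprn_gt0.
have pi0 := pi_gt0 R.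
have NE : 4 ^+ n = 2 ^+ n * 2 ^+ n :> R by rewrite -exprMn -natrM.
suff : \sum_(k < 2 ^ n) (16 * (2 ^+ n * 2 ^+ n) / pi ^+ 2) * f k <= 2 * 4 ^+ n :> R.
  rewrite -mulr_sumr NE -ler_pdivlMl ?divr_gt0 ?mulr_gt0 ?exprn_gt0//.
  move=> /le_trans; apply; rewrite le_eqVlt; apply/orP; left; apply/eqP.
  by clear -pi0 N0; move: (2 ^+ n) (@pi R) N0 pi0 => a b a0 b0; field; rewrite !gt_eqF.
rewrite -sum_inv_sin2; apply: ler_sum => k _.
have k0 : 0 < (2 * k + 1)%:R :> R by rewrite ltr0n addn1.
have kn : (2 * k + 1)%:R < 2 * 2 ^+ n :> R.
  rewrite -natrX -natrM ltr_nat (leq_trans _ (leq_mul (leqnn 2) (ltn_ord k)))//.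
  by rewrite mulnS add2n addn1.
set x := _ * pi / _.
have x0 : 0 < x by rewrite /x divr_gt0 ?mulr_gt0.
have xpi : x < pi by rewrite /x ltr_pdivrMr ?mulr_gt0// mulrC ltr_pM2l//; lra.
have -> : 16 * (2 ^+ n * 2 ^+ n) / pi ^+ 2 * f k = (x ^+ 2)^-1.
  rewrite /f /x; clear -pi0 N0 k0.
  by move: (2 ^+ n) (@pi R) ((2 * k + 1)%:R) N0 pi0 k0 => a b e a0 b0 e0; field; rewrite !gt_eqF.
have sx : 0 < sin x by rewrite sin_gt0_pi// x0.
have sxx := sin_le_id (ltW x0).
by rewrite lef_pV2 ?posrE ?exprn_gt0// ler_sqr ?nnegrE//; exact: ltW.
Qed.

Lemma sum_inv_sqr_double n :
  \sum_(k < 2 * n) (k.+1%:R ^+ 2)^-1 =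
  \sum_(k < n) ((2 * k + 1)%:R ^+ 2)^-1 + (\sum_(k < n) (k.+1%:R ^+ 2)^-1) / 4 :> R.
Proof.
elim: n => [|n ih]; first by rewrite muln0 !big_ord0; field.
rewrite mulnS add2n !big_ord_recr/= ih.
have -> : (2 * n).+2%:R = 2 * n.+1%:R :> R by rewrite -natrM mulnS add2n.
have a0 : n.+1%:R != 0 :> R by rewrite pnatr_eq0.
have b0 : (2 * n).+1%:R != 0 :> R by rewrite pnatr_eq0.
rewrite addn1; move: (n.+1%:R) ((2 * n).+1%:R) a0 b0 => a b a0 b0.
by field; rewrite ?a0 ?b0.
Qed.

(** Splitting odd and even denominators gives [S_n <= S_2n <= pi ^ 2 / 8 + S_n / 4], which is solved
    for [S_n]. *)
Lemma sum_inv_sqr_le n : \sum_(k < n) (k.+1%:R ^+ 2)^-1 <= @kappa R.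
Proof.
have mono : \sum_(k < n) (k.+1%:R ^+ 2)^-1 <= \sum_(k < 2 * n) (k.+1%:R ^+ 2)^-1 :> R.
  have n2 : (n <= 2 * n)%N by rewrite leq_pmull.
  rewrite -!(big_mkord xpredT (fun k => (k.+1%:R ^+ 2)^-1)).
  rewrite [leRHS](big_cat_nat (leq0n n) n2)//= lerDl.
  by apply: sumr_ge0 => k _; rewrite invr_ge0 sqr_ge0.
have := sum_inv_sqr_double n; have := sum_inv_odd2_le n; rewrite /kappa; move: mono.
by lra.
Qed.

Lemma kappa_ge1 : 1 <= @kappa R.
Proof.
have := sum_inv_sqr_le 1; rewrite big_ord_recl big_ord0 addr0/=.
by rewrite expr1n invr1.
Qed.

Lemma ln_ltB1 x : 0 < x -> x != 1 -> ln x < x - 1.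
Proof.
move=> x0 x1; rewrite -ltr_expR lnK ?posrE//.
by rewrite -{1}(subrK 1 x) addrC expR_gt1Dx// subr_eq0.
Qed.

Lemma ln_leB1 x : 0 < x -> ln x <= x - 1.
Proof.
by move=> x0; have := @le_ln1Dx R (x - 1); rewrite (addrC 1) subrK; apply; lra.
Qed.

(** The derivative is [u - 1 - ln u >= 0] at [u = x / (x + c)]. On a linear boundary this reduces
    the requirement at all thresholds above [s] to the one at [s]. *)
Lemma mul_ln1D_ndecr c s t : 0 <= c -> 0 < s -> s <= t ->
  s * ln (1 + c / s) <= t * ln (1 + c / t).
Proof.
move=> c0 s0 st.
pose f x := x * (ln (x + c) - ln x).
have fE x : 0 < x -> x * ln (1 + c / x) = f x.
  move=> x0; rewrite /f -ln_div ?posrE//; last by rewrite ltr_pwDl.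
  by congr (_ * ln _); field; rewrite gt_eqF.
rewrite !fE//; last exact: lt_le_trans st.
apply: (@derive_ge0_le R f
  (fun x => ln (x + c) - ln x + x * ((x + c)^-1 - x^-1))) => // x /andP[sx _];
  have x0 : 0 < x by [exact: lt_le_trans sx];
  have xc0 : 0 < x + c by [rewrite ltr_pwDl].
  have d1 : is_derive x 1 (fun x => x + c) 1.
    by apply: is_derive_eq; rewrite addr0.
  have d2 := is_derive_lnf d1 xc0.
  have d3 := is_derive1_ln x0.
  by apply: is_derive_eq; rewrite /GRing.scale/=; ring.
have -> : ln (x + c) - ln x + x * ((x + c)^-1 - x^-1) =
    x / (x + c) - 1 - ln (x / (x + c)).
  by rewrite ln_div ?posrE//; field; rewrite !gt_eqF.
by rewrite subr_ge0 ln_leB1// divr_gt0.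
Qed.

(** The difference is [y (ln y - ln x) - (y - x) + (y - x) ln x], where the first term exceeds
    [y - x] and the last is nonnegative. *)
Lemma h_fun_lt x y : 1 <= x -> x < y -> h_fun x < h_fun y.
Proof.
move=> x1 xy; have x0 : 0 < x by exact: lt_le_trans x1.
have y0 : 0 < y by exact: lt_trans xy.
have Lxy : 1 - x / y < ln y - ln x.
  have := @ln_ltB1 (x / y); rewrite divr_gt0// ln_div ?posrE// => /(_ isT).
  rewrite lt_eqF ?ltr_pdivrMr ?mul1r// => /(_ isT); lra.
have lx : 0 <= ln x by exact: ln_ge0.
have : y - x < y * (ln y - ln x).
  by rewrite -ltr_pdivrMl// mulrC mulrBl divff ?gt_eqF.
have : 0 <= (y - x) * ln x by rewrite mulr_ge0// subr_ge0 ltW.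
by rewrite /h_fun; lra.
Qed.

Lemma h_fun_surj t : 0 < t -> exists y, 1 < y /\ h_fun y = t.
Proof.
(* [ln b >= 2] gives [h_fun b >= b + 1 > t], so the intermediate value theorem applies on
   [[1, b]]. *)
move=> t0; pose b : R := expR 2 + t.
have e2 : 1 < expR 2 :> R by rewrite expR_gt1.
have b1 : 1 <= b by rewrite /b; lra.
have h1 : h_fun 1 = 0 :> R by rewrite /h_fun ln1; ring.
have hb : t <= h_fun b.
  have lb : 2 <= ln b by rewrite -ler_expR lnK ?posrE /b; lra.
  have : 0 <= b * (ln b - 2) by rewrite mulr_ge0 ?subr_ge0// /b; lra.
  rewrite /h_fun /b; lra.
have hc : {within `[1, b], continuous h_fun}.
  apply: derivable_within_continuous => x; rewrite in_itv/= => /andP[x1 _].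
  have dln : is_derive x 1 (@ln R) x^-1 by apply: is_derive1_ln; lra.
  have : is_derive x 1 (@h_fun R) (ln x).
    rewrite /h_fun; apply: is_derive_eq; rewrite /GRing.scale/=; field.
    by rewrite gt_eqF//; lra.
  by move=> ?; exact: ex_derive.
have [|y] := @IVT R h_fun 1 b t b1 hc.
  by rewrite h1 ge_min le_max hb orbT ltW.
rewrite in_itv/= => /andP[y1 _] hy; exists y; split => //.
rewrite lt_neqAle y1 andbT; apply/eqP => y1'.
by move: hy; rewrite -y1' h1 => t0'; rewrite -t0' ltxx in t0.
Qed.

Lemma h_invP t : 0 < t -> 1 < h_inv t /\ h_fun (h_inv t) = t.
Proof.
by move=> /h_fun_surj hex; have := xgetPex 1 hex.
Qed.

Lemma h_fun_le x y : 1 <= x -> x <= y -> h_fun x <= h_fun y.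
Proof.
by move=> x1; rewrite le_eqVlt => /predU1P[->//|xy]; exact/ltW/h_fun_lt.
Qed.

End RealFacts.

(** * Crossing probabilities of the null counting process *)

Section FiniteProbability.
Context {d : measure_display} {T : measurableType d} {R : realType}.

(** The event is a finite union over the truth patterns [v] satisfying [Q]; it serves for events
    stated through counts. *)
Lemma measurable_finite_pred (I : finType) (b : I -> T -> bool)
    (Q : {ffun I -> bool} -> bool) :
  (forall i, measurable [set w | b i w]) ->
  measurable [set w | Q [ffun i => b i w]].
Proof.
move=> mb.
have -> : [set w | Q [ffun i => b i w]] =
    \bigcup_(v in [set v | Q v]) \bigcap_(i in setT) [set w | b i w = v i].
  apply/seteqP; split => [w /= Qw|w [v /= Qv vw]].
    by exists [ffun i => b i w] => //= i _ /=; rewrite ffunE.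
  by rewrite (_ : [ffun i => b i w] = v)//; apply/ffunP => i; rewrite ffunE vw.
apply: fin_bigcup_measurable => // v _.
apply: fin_bigcap_measurable => // i _.
case: (v i); first exact: mb.
rewrite (_ : [set _ | _] = ~` [set w | b i w]); first exact/measurableC/mb.
by apply/seteqP; split => w /=; case: (b i w).
Qed.

Context (P : probability T R).

Definition Pr (A : set T) : R := fine (P A).

Lemma PrE A : measurable A -> P A = (Pr A)%:E.
Proof. by move=> mA; rewrite /Pr fineK// fin_num_measure. Qed.

Lemma Pr_ge0 A : 0 <= Pr A.
Proof. exact: fine_ge0. Qed.

Lemma le_Pr A B : measurable A -> measurable B -> A `<=` B -> Pr A <= Pr B.
Proof.
by move=> mA mB AB; rewrite -lee_fin -!PrE// le_measure// inE.
Qed.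

Lemma Pr_le1 A : measurable A -> Pr A <= 1.
Proof. by move=> mA; rewrite -lee_fin -PrE// probability_le1. Qed.

Lemma Pr_setT : Pr setT = 1.
Proof. by rewrite /Pr probability_setT. Qed.

Lemma Pr_set0 : Pr set0 = 0.
Proof. by rewrite /Pr measure0. Qed.

Lemma PrD A B : measurable A -> measurable B -> B `<=` A ->
  Pr (A `\` B) = Pr A - Pr B.
Proof.
move=> mA mB BA; apply: EFin_inj; rewrite -PrE; last exact: measurableD.
rewrite measureD//; last by rewrite ltey_eq fin_num_measure.
by rewrite (setIidr BA) EFinB -!PrE.
Qed.

Lemma PrU_le A B : measurable A -> measurable B -> Pr (A `|` B) <= Pr A + Pr B.
Proof.
move=> mA mB; rewrite -lee_fin -PrE; last exact: measurableU.
by rewrite EFinD -!PrE// measureU2.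
Qed.

Lemma Pr_cover (I : finType) (A : set T) (B : I -> set T) :
  measurable A -> (forall i, measurable (B i)) ->
  A `<=` \bigcup_i B i -> Pr A <= \sum_i Pr (B i).
Proof.
move=> mA mB AB.
have mU (s : seq I) : measurable (\big[setU/set0]_(i <- s) B i).
  exact: bigsetU_measurable.
apply: (@le_trans _ _ (Pr (\big[setU/set0]_(i <- index_enum I) B i))).
  apply: le_Pr => // w /AB[i _ Biw].
  by rewrite -bigcup_seq; exists i => //=; exact: mem_index_enum.
elim: (index_enum I) => [|i s ih]; first by rewrite !big_nil Pr_set0.
by rewrite !big_cons (le_trans (PrU_le _ _))// lerD2l.
Qed.

End FiniteProbability.

Lemma prodrD_subsets (R : comNzRingType) (I : finType) (S : {set I}) (a b : I -> R) :
  \prod_(i in S) (a i + b i) =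
  \sum_(J : {set I} | J \subset S) \prod_(i in S :\: J) a i * \prod_(i in J) b i.
Proof.
rewrite big_mkcond/=.
(* Outside [S] the factor is written [0 + 1], so that only subsets of [S] survive in the expansion
   over all subsets. *)
transitivity (\prod_i ((if i \in S then b i else 0) + (if i \in S then a i else 1))).
  by apply: eq_bigr => i _; case: ifP; rewrite ?add0r// addrC.
rewrite bigA_distr [RHS]big_mkcond/=; apply: eq_big => [J|J _]; first by rewrite inE.
have [JS|/subsetPn[i iJ iS]] := ifPn; last first.
  by rewrite (bigD1 i)//= iJ (negbTE iS) mul0r.
rewrite [in RHS]big_mkcond [X in _ * X]big_mkcond -big_split/=.
apply: eq_bigr => i _; rewrite finset.in_setD.
case: (boolP (i \in J)) => [iJ|iJ] /=; first by rewrite (fintype.subsetP JS)// mul1r.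
by rewrite mulr1; case: ifP.
Qed.

(** * The maximal inequality for the null counting process *)

Section NullCounts.
Context {d : measure_display} {T : measurableType d} {R : realType}.
Context (P : probability T R) {m : nat} (p : 'I_m -> T -> R) (H0 : {set 'I_m}).
Context (mp : forall i, measurable_fun setT (p i)).
Context (p01 : forall i t, 0 <= p i t <= 1).
Context (superunif : forall i, i \in H0 -> forall x : R,
     (P [set t | (p i t <= x)%R] <= (Num.max 0 (Num.min x 1))%:E)%E).
Context (indep : mutually_independent P H0 p).
Implicit Types (S J : {set 'I_m}) (s : R) (ts : seq (R * nat)).

Let law i (X : set R) : R := Pr P (p i @^-1` X).
Let F i s : R := law i [set x | x <= s].

Definition count_le S s t : nat := #|[set i in S | p i t <= s]%SET|.

Definition crosses S ts : set T :=
  [set t | has (fun sj => (sj.2 <= count_le S sj.1 t)%N) ts].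

Lemma measurable_preimage_p i (X : set R) : measurable X -> measurable (p i @^-1` X).
Proof. by move=> mX; rewrite -[X in measurable X]setTI; exact: mp. Qed.

Lemma measurable_count_le S s (Q : nat -> bool) : measurable [set t | Q (count_le S s t)].
Proof.
pose Q' (v : {ffun 'I_m -> bool}) := Q #|[set i in S | v i]%SET|.
have -> : [set t | Q (count_le S s t)] = [set t | Q' [ffun i => p i t <= s]].
  apply/seteqP; split=> t /=; rewrite /count_le /Q';
    rewrite (_ : [set i in S | p i t <= s]%SET =
      [set i in S | [ffun i => p i t <= s] i]%SET)//;
    by apply/finset.setP => i; rewrite !inE ffunE.
apply: (measurable_finite_pred (b := fun i t => p i t <= s)) => i.
exact: (measurable_preimage_p i (measurable_itv `]-oo, s])).
Qed.

Lemma measurable_crosses S ts : measurable (crosses S ts).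
Proof.
elim: ts => [|sj ts ih]; first by rewrite (_ : crosses _ _ = set0)// -subset0.
rewrite (_ : crosses S _ =
  [set t | (sj.2 <= count_le S sj.1 t)%N] `|` crosses S ts).
  apply: measurableU => //; exact: (measurable_count_le S sj.1 (leq sj.2)).
by apply/seteqP; split => t /=; rewrite /crosses/=; [move/orP|move=> ?; apply/orP].
Qed.

Let cell (B : 'I_m -> set R) : set T :=
  \bigcap_(j in [set j | j \in H0]) (p j @^-1` B j).

Lemma measurable_cell B : (forall i, i \in H0 -> measurable (B i)) ->
  measurable (cell B).
Proof.
move=> mB; apply: fin_bigcap_measurable => // i /= iH.
apply: measurable_preimage_p; exact: mB.
Qed.

Lemma Pr_cell B : (forall i, i \in H0 -> measurable (B i)) ->
  Pr P (cell B) = \prod_(i in H0) law i (B i).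
Proof.
move=> mB; apply: EFin_inj; rewrite -PrE; last exact: measurable_cell.
rewrite indep//.
rewrite (eq_bigr (fun i => (law i (B i))%:E)) => [|i iH]; last first.
  by rewrite PrE//; apply: measurable_preimage_p; exact: mB.
by rewrite prodEFin.
Qed.

Lemma law_ge0 i X : 0 <= law i X. Proof. exact: Pr_ge0. Qed.

Lemma law_le i s : i \in H0 -> 0 <= s -> F i s <= s.
Proof.
move=> iH s0; rewrite -lee_fin -PrE; last first.
  exact: (measurable_preimage_p i (measurable_itv `]-oo, s])).
apply: (le_trans (superunif iH s)); rewrite lee_fin ge_max s0 /=.
by rewrite ge_min lexx.
Qed.

Lemma law_oc i s t : s <= t -> law i [set x | s < x <= t] = F i t - F i s.
Proof.
move=> st; rewrite /F /law -PrD.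
- congr Pr; apply/seteqP; split => w /=.
    by move=> /andP[sw wt]; split => //; apply/negP; rewrite -ltNge.
  by move=> [-> /negP]; rewrite -ltNge => ->.
- exact: (measurable_preimage_p i (measurable_itv `]-oo, t])).
- exact: (measurable_preimage_p i (measurable_itv `]-oo, s])).
- by move=> w /= /le_trans; exact.
Qed.

(* Conditioning: [cell B] fixes the position of the null p-values outside [S], and puts
   those in [S] below the current time [t0.1]. With [F i] the distribution function of
   [p i], the right-hand side is the integral over [cell B] of the martingale
   [\prod_(i in S) (1 + c / F i t) - 1] at that time, written without divisions
   because [F i t] may vanish. *)
Lemma Pr_crosses_cell c L ts : 0 <= c ->
  (forall sj, sj \in ts -> 0 < sj.1 /\ L <= (1 + c / sj.1) ^+ sj.2) ->
  forall S t0 B, path (fun x y : R * nat => y.1 <= x.1) t0 ts ->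
  S \subset H0 -> (forall i, i \in H0 -> measurable (B i)) ->
  (forall i, i \in S -> B i = [set x | x <= t0.1]) ->
  Pr P (cell B `&` crosses S ts) * (L - 1) <=
  \prod_(i in H0 :\: S) law i (B i) *
  (\prod_(i in S) (F i t0.1 + c) - \prod_(i in S) F i t0.1).
Proof.
move=> c0; elim: ts => [|[s j] ts ih] tsP S [t k] B /= tsort SH mB BS.
  rewrite (_ : crosses _ _ = set0); last by rewrite -subset0.
  rewrite setI0 Pr_set0 mul0r mulr_ge0 ?prodr_ge0// => [i _|]; first exact: law_ge0.
  rewrite subr_ge0 ler_prod// => i _; rewrite law_ge0/= lerDl//.
have [s0 Ls] := tsP _ (mem_head _ _).
have {}ih := ih (fun sj sjts => tsP sj (@mem_behead _ ((s, j) :: ts) _ sjts)).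
move: tsort => /= /andP[st tsort].
(* [J] is the set of indices of [S] still at or below [s]; the others are frozen in []s, t]], and
   [J] takes over the role of [S] at the next threshold. *)
pose BJ J i : set R := if i \in S then
  (if i \in J then [set x | x <= s] else [set x | s < x <= t]) else B i.
have mBJ J i : i \in H0 -> measurable (BJ J i).
  move=> iH; rewrite /BJ; case: ifPn => _; last exact: mB.
  by case: ifPn => _; [exact: (measurable_itv `]-oo, s])|
                       exact: (measurable_itv `]s, t])].
pose G J := if J \subset S then cell (BJ J) `&` (if (j <= #|J|)%N then setT else crosses J ts)
  else set0.
have mG J : measurable (G J).
  rewrite /G; case: ifPn => // JS; apply: measurableI.
    by apply: measurable_cell => i; exact: mBJ.
  by case: ifPn => // _; exact: measurable_crosses.
have cover : cell B `&` crosses S ((s, j) :: ts) `<=` \bigcup_J G J.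
  move=> w [cw hw]; pose J := [set i in S | p i w <= s]%SET; exists J => //.
  have JS : J \subset S by apply/fintype.subsetP => i; rewrite inE => /andP[].
  rewrite /G JS; split.
    move=> i /= iH; rewrite /BJ; have := cw i iH; case: ifPn => // iS /=.
    rewrite BS// inE iS /= => pt; case: (leP (p i w) s) => //= sp.
    by rewrite sp.
  case: ifPn => // jJ; move: hw; rewrite /crosses /= [(j <= _)%N](negbTE jJ)/=.
  (* The later thresholds are at most [s], so they count only indices of [J]. *)
  move=> /hasP[sj sjts cnt]; apply/hasP; exists sj => //.
  have sjs : sj.1 <= s.
    have rtr : transitive (fun x y : R * nat => y.1 <= x.1).
      by move=> x y z yx xz; exact: le_trans xz yx.
    by have /allP/(_ _ sjts) := order_path_min rtr tsort.
  rewrite (leq_trans cnt)// subset_leq_card//; apply/fintype.subsetP => i.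
  rewrite !inE => /andP[-> psj] /=.
  by rewrite psj (le_trans psj).
(* The union bound over [J] will be multiplied by [L - 1]; if this is negative, the left side is at
   most 0 already. *)
have [L1|L1] := ltP L 1.
  apply: (@le_trans _ _ 0).
    by rewrite mulr_ge0_le0 ?Pr_ge0// subr_le0 ltW.
  rewrite mulr_ge0 ?prodr_ge0// => [i _|]; first exact: law_ge0.
  by rewrite subr_ge0 ler_prod// => i _; rewrite law_ge0/= lerDl.
apply: (@le_trans _ _ ((\sum_J Pr P (G J)) * (L - 1))).
  rewrite ler_wpM2r ?subr_ge0// Pr_cover//.
  by apply: measurableI; [exact: measurable_cell|exact: measurable_crosses].
rewrite mulr_suml.
rewrite (bigID (fun J => J \subset S))/= [X in _ + X]big1 ?addr0; last first.
  by move=> J JS; rewrite /G (negbTE JS) Pr_set0 mul0r.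
(* If [#|J| < j], this is the induction hypothesis. Otherwise the process stops at [s], and
   [F i s <= s] gives [L <= (1 + c / s) ^+ #|J| <= \prod_(i in J) (1 + c / F i s)], multiplied
   through by the [F i s]. *)
have GJ J : J \subset S -> Pr P (G J) * (L - 1) <=
    \prod_(i in H0 :\: J) law i (BJ J i) *
    (\prod_(i in J) (F i s + c) - \prod_(i in J) F i s).
  move=> JS; have JH := fintype.subset_trans JS SH.
  rewrite /G JS; case: ifPn => jJ; last first.
    apply: (ih J (s, j)) => // [i|i iJ]; first exact: mBJ.
    by rewrite /BJ iJ (fintype.subsetP JS).
  rewrite setIT Pr_cell//; last by move=> i; exact: mBJ.
  rewrite (big_setID J)/= (finset.setIidPr JH) mulrAC mulrC ler_wpM2l//.
    by apply: prodr_ge0 => i _; exact: law_ge0.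
  rewrite (eq_bigr (F ^~ s)) => [|i iJ]; last by rewrite /BJ iJ (fintype.subsetP JS).
  rewrite mulrBr mulr1 lerD2r.
  apply: (@le_trans _ _ (\prod_(i in J) F i s * (1 + c / s) ^+ #|J|)).
    rewrite ler_wpM2l ?prodr_ge0// => [i _|]; first exact: law_ge0.
    rewrite (le_trans Ls)// ler_weXn2l// lerDl divr_ge0// ltW//.
  rewrite -prodr_const -big_split/= ler_prod// => i iJ.
  have iH : i \in H0 by exact: (fintype.subsetP JH).
  have cs0 : 0 <= c / s by rewrite divr_ge0// ltW.
  rewrite mulr_ge0 ?law_ge0 ?addr_ge0//=.
  rewrite mulrDr mulr1 lerD2l mulrA ler_pdivrMr// mulrC ler_wpM2l// law_le// ltW//.
apply: (le_trans (ler_sum _ GJ)).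
rewrite [leRHS](_ : _ = \sum_(J : {set 'I_m} | J \subset S)
  \prod_(i in H0 :\: J) law i (BJ J i) *
    (\prod_(i in J) (F i s + c) - \prod_(i in J) F i s))//.
(* The martingale property: expanding both products over the set [J] of indices that remain below
   [s] reproduces the sum of the bounds [GJ]. *)
have -> : \prod_(i in S) (F i t + c) =
    \prod_(i in S) ((F i t - F i s) + (F i s + c)).
  by apply: eq_bigr => i _; rewrite addrA subrK.
have -> : \prod_(i in S) F i t = \prod_(i in S) ((F i t - F i s) + F i s).
  by apply: eq_bigr => i _; rewrite subrK.
rewrite !prodrD_subsets -sumrB mulr_sumr; apply: eq_bigr => J JS.
rewrite -mulrBr mulrA; congr (_ * _).
rewrite [RHS](big_setID S)/= mulrC; congr (_ * _).
  rewrite (_ : (H0 :\: J) :&: S = S :\: J); last first.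
    apply/finset.setP => i; rewrite !inE.
    by case: (boolP (i \in S)) => [/(fintype.subsetP SH) ->|]; rewrite ?andbT ?andbF.
  apply: eq_bigr => i; rewrite finset.in_setD => /andP[/negbTE iJ iS].
  by rewrite /BJ iS iJ law_oc.
rewrite (_ : (H0 :\: J) :\: S = H0 :\: S); last first.
  apply/finset.setP => i; rewrite !inE.
  case: (boolP (i \in S)) => //= iS; case: (boolP (i \in J)) => //.
  by move=> /(fintype.subsetP JS); rewrite (negbTE iS).
by apply: eq_bigr => i; rewrite finset.in_setD => /andP[/negbTE iS _]; rewrite /BJ iS.
Qed.

(** Start at time 1, where every [F i] equals 1 and the cell is the whole space. *)
Lemma Pr_crosses c L ts : 0 <= c ->
  (forall sj, sj \in ts -> 0 < sj.1 <= 1 /\ L <= (1 + c / sj.1) ^+ sj.2) ->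
  sorted (fun x y : R * nat => y.1 <= x.1) ts ->
  Pr P (crosses H0 ts) * (L - 1) <= (1 + c) ^+ m - 1.
Proof.
move=> c0 tsP tsort.
pose B (i : 'I_m) : set R := [set x | x <= 1].
have mB (i : 'I_m) : i \in H0 -> measurable (B i).
  by move=> _; exact: (measurable_itv `]-oo, 1]).
have F1 i : F i 1 = 1.
  rewrite /F /law (_ : _ @^-1` _ = setT) ?Pr_setT//.
  by apply/seteqP; split => // w _ /=; have /andP[] := p01 i w.
have pathts : path (fun x y : R * nat => y.1 <= x.1) (1, 0%N) ts.
  case: ts tsP tsort => //= sj ts tsP ->; rewrite andbT.
  by have [/andP[]] := tsP _ (mem_head _ _).
have tsP' sj : sj \in ts -> 0 < sj.1 /\ L <= (1 + c / sj.1) ^+ sj.2.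
  by move=> /tsP[/andP[]].
have := Pr_crosses_cell c0 tsP' pathts (subxx _) mB (fun i _ => erefl).
rewrite (_ : cell B = setT) ?setTI; last first.
  by apply/seteqP; split => // w _ i /= _; have /andP[] := p01 i w.
move=> /le_trans; apply; rewrite finset.setDv big_set0 mul1r.
rewrite (eq_bigr (fun=> 1 + c)); last by move=> i _; rewrite F1.
rewrite [X in _ - X]big1; last by move=> i _; rewrite F1.
rewrite prodr_const lerD2r ler_weXn2l ?lerDl// (leq_trans (max_card _))//.
by rewrite card_ord.
Qed.

(** Convenient when [L] is exponentially large. Simes' inequality uses the sharper [Pr_crosses],
    since there [L - 1] and [(1 + c) ^+ m - 1] tend to 0 together. *)
Corollary Pr_crosses_le c L ts : 0 <= c ->
  (forall sj, sj \in ts -> 0 < sj.1 <= 1 /\ L <= (1 + c / sj.1) ^+ sj.2) ->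
  sorted (fun x y : R * nat => y.1 <= x.1) ts ->
  Pr P (crosses H0 ts) * L <= (1 + c) ^+ m.
Proof.
move=> c0 tsP tsort; have := Pr_crosses c0 tsP tsort.
by have := Pr_le1 P (measurable_crosses H0 ts); lra.
Qed.

End NullCounts.

(** * The joint error event *)

Lemma measurable_ltf (d : measure_display) (T : measurableType d) (R : realType)
    (f g : T -> R) :
  measurable_fun setT f -> measurable_fun setT g -> measurable [set t | f t < g t].
Proof.
move=> mf mg; rewrite (_ : [set t | f t < g t] = setT `&` (g \- f) @^-1` `]0, +oo[%classic).
  by apply: measurable_funB => //; exact: measurable_itv.
by rewrite setTI; apply/seteqP; split => t /=; rewrite in_itv/= andbT subr_gt0.
Qed.

Lemma measurable_lef (d : measure_display) (T : measurableType d) (R : realType)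
    (f g : T -> R) :
  measurable_fun setT f -> measurable_fun setT g -> measurable [set t | f t <= g t].
Proof.
move=> mf mg; rewrite (_ : [set t | f t <= g t] = ~` [set t | g t < f t]).
  exact/measurableC/measurable_ltf.
by apply/seteqP; split => t /=; [rewrite ltNge => -> //|rewrite leNgt => /negP].
Qed.

Section JointErrorRate.
Context {d : measure_display} {T : measurableType d} {R : realType}.
Context (P : probability T R) {m : nat} (p : 'I_m -> T -> R) (H0 : {set 'I_m}).
Context (sigma : T -> {perm 'I_m}).
Context (mp : forall i, measurable_fun setT (p i)).
Context (p01 : forall i t, 0 <= p i t <= 1).
Context (superunif : forall i, i \in H0 -> forall x : R,
     (P [set t | (p i t <= x)%R] <= (Num.max 0 (Num.min x 1))%:E)%E).
Context (psorted : forall t (i j : 'I_m),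
  (i <= j)%N -> p (sigma t i) t <= p (sigma t j) t).

Lemma Rfam_card_le t (k : 'I_m) :
  (#|Rfam (sigma t) k :&: H0| <= count_le p H0 (p (sigma t k) t) t)%N.
Proof.
apply: subset_leq_card; apply/fintype.subsetP => i; rewrite !inE => /andP[].
move=> /imsetP[j]; rewrite inE => jk -> -> /=; exact: psorted.
Qed.

Lemma card_Rfam_le t (k : 'I_m) : (#|Rfam (sigma t) k :&: H0| <= k.+1)%N.
Proof.
apply: (leq_trans (subset_leq_card (finset.subsetIl _ _))).
apply: (leq_trans (leq_imset_card _ _)).
rewrite (@eq_card _ _ [pred j : 'I_m | (j < k.+1)%N]); last by move=> j; rewrite !inE ltnS.
by rewrite -sum1_card -(big_ord_widen m (fun=> 1%N) (ltn_ord k)) sum1_card card_ord.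
Qed.

(* Ties: the last index [k] of a block of equal p-values has [R_k = {i | p_i <= p_(k)}],
   so the error event does not depend on the choice of [sigma]. *)
Lemma Rfam_last t (i : 'I_m) : exists2 k : 'I_m, p (sigma t k) t = p i t &
  (count_le p H0 (p i t) t <= #|Rfam (sigma t) k :&: H0|)%N.
Proof.
pose k0 : 'I_m := ((sigma t)^-1)%g i.
have sk0 : sigma t k0 = i by rewrite /k0 permKV.
have Pk0 : p (sigma t k0) t <= p i t by rewrite sk0.
case: (@arg_maxnP _ k0 (fun k => p (sigma t k) t <= p i t) val Pk0) => k pk kmax.
exists k.
  by apply/le_anti; rewrite pk /= -{1}sk0; apply: psorted; exact: kmax.
apply: subset_leq_card; apply/fintype.subsetP => j; rewrite !inE => /andP[-> pj].
rewrite andbT; apply/imsetP; exists (((sigma t)^-1)%g j); last by rewrite permKV.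
by rewrite inE; apply: kmax; rewrite permKV.
Qed.

(** The cap at [k] never causes an error, as [R_k] has at most [k] elements. The right-hand event is
    free of [sigma], so its measurability follows from that of the p-values. *)
Lemma JER_eventE (Z : R -> int) (zeta : R -> nat -> int) :
  (forall q k, 0 <= q <= 1 -> zeta q k = Num.min (Z q) k%:Z) ->
  [set t | exists k : 'I_m,
    (zeta (p (sigma t k) t) k.+1 < (#|Rfam (sigma t) k :&: H0|)%:Z)%R] =
  [set t | exists i : 'I_m, Z (p i t) < (count_le p H0 (p i t) t)%:Z].
Proof.
move=> zetaE; apply/seteqP; split => t /= [k].
  rewrite zetaE// gt_min => /orP[Zlt|]; last first.
    by rewrite ltz_nat ltnNge card_Rfam_le.
  exists (sigma t k); apply: (lt_le_trans Zlt).
  by rewrite lez_nat Rfam_card_le.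
move=> Zlt; have [k' pk' cnt] := Rfam_last t k; exists k'.
by rewrite zetaE// pk' gt_min (lt_le_trans Zlt).
Qed.

Lemma measurable_JER_event (Z : R -> int) :
  (forall n : nat, measurable [set q : R | 0 <= q <= 1 /\ Z q < n%:Z]) ->
  measurable [set t | exists i : 'I_m, Z (p i t) < (count_le p H0 (p i t) t)%:Z].
Proof.
move=> mZ.
rewrite (_ : [set t | _] = \bigcup_(i : 'I_m) \bigcup_n
  ([set t | Z (p i t) < n%:Z] `&` [set t | count_le p H0 (p i t) t == n])); last first.
  apply/seteqP; split => t /=.
    by move=> [i Zi]; exists i => //; exists (count_le p H0 (p i t) t) => //=.
  by move=> [i _ [n _ [/= Zn /eqP cn]]]; exists i; rewrite cn.
apply: fin_bigcup_measurable => // i _; apply: bigcup_measurable => n _.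
apply: measurableI.
  rewrite (_ : [set t | _] = p i @^-1` [set q : R | 0 <= q <= 1 /\ Z q < n%:Z]).
    by apply: measurable_preimage_p => //; exact: mZ.
  by apply/seteqP; split => t /=; [|case].
pose Q (v : {ffun 'I_m -> bool}) := #|[set j in H0 | v j]%SET| == n.
rewrite (_ : [set t | _] = [set t | Q [ffun j => p j t <= p i t]]).
  apply: (measurable_finite_pred (b := fun j t => p j t <= p i t)) => j.
  exact: measurable_lef.
apply/seteqP; split => t /=; rewrite /count_le /Q;
  rewrite (_ : [set j in H0 | p j t <= p i t]%SET =
     [set j in H0 | [ffun j => p j t <= p i t] j]%SET)//;
  by apply/finset.setP => j; rewrite !inE ffunE.
Qed.

Lemma measurable_null_p_le0 : measurable [set t | exists2 i, i \in H0 & p i t <= 0].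
Proof.
rewrite (_ : [set t | _] = \bigcup_(i in [set i | i \in H0]) [set t | p i t <= 0])//.
apply: fin_bigcup_measurable => // i _.
exact: (measurable_preimage_p mp i (measurable_itv `]-oo, 0])).
Qed.

Lemma Pr_null_p_eq0 : Pr P [set t | exists2 i, i \in H0 & p i t <= 0] = 0.
Proof.
have mi i : measurable [set t | p i t <= 0].
  exact: (measurable_preimage_p mp i (measurable_itv `]-oo, 0])).
have mE := measurable_null_p_le0.
apply/eqP; rewrite eq_le Pr_ge0 andbT.
pose B i := if i \in H0 then [set t | p i t <= 0] else set0.
have mB i : measurable (B i) by rewrite /B; case: ifP.
apply: (le_trans (@Pr_cover _ _ _ P _ _ B mE mB _)).
  by move=> t [i iH pi0]; exists i => //; rewrite /B iH.
apply: sumr_le0 => i _; rewrite /B; case: ifPn => iH; last by rewrite Pr_set0.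
rewrite -lee_fin -PrE//; apply: (le_trans (superunif iH 0)).
by rewrite lee_fin ge_max lexx ge_min lexx.
Qed.

(** An error at [q = 0] requires a null p-value equal to 0, which has probability 0 by (A1) at
    [x = 0]; errors at [q > 0] fall into [D]. *)
Lemma JER_le (Z : R -> int) (zeta : R -> nat -> int) (D : set T) (a : R) :
  (forall q k, 0 <= q <= 1 -> zeta q k = Num.min (Z q) k%:Z) ->
  (forall n : nat, measurable [set q : R | 0 <= q <= 1 /\ Z q < n%:Z]) ->
  Z 0 = 0 -> measurable D -> Pr P D <= a ->
  (forall t q, 0 < q <= 1 -> Z q < (count_le p H0 q t)%:Z -> D t) ->
  (JER P H0 (fun t => Rfam (sigma t))
     (fun t k => zeta (p (sigma t k) t) k.+1) <= a%:E)%E.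
Proof.
move=> zetaE mZ Z0 mD Da ZD; rewrite /JER (JER_eventE zetaE).
have mE := measurable_JER_event mZ.
have m0 := measurable_null_p_le0.
rewrite PrE// lee_fin.
apply: (le_trans (le_Pr (B := D `|` [set t | exists2 i, i \in H0 & p i t <= 0]) _ _ _ _)).
- exact: mE.
- exact: measurableU.
- move=> t /= [i Zi]; have /andP[pi0 pi1] := p01 i t.
  move: pi0; rewrite le_eqVlt => /predU1P[pi0|pi0]; last first.
    by left; apply: ZD Zi; rewrite pi0.
  right; move: Zi; rewrite -pi0 Z0 ltz_nat /count_le => /card_gt0P[j].
  by rewrite inE => /andP[jH pj]; exists j.
by rewrite (le_trans (PrU_le _ mD m0))// Pr_null_p_eq0 addr0.
Qed.

End JointErrorRate.

(** * Three boundaries *)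

(** The reversal lists a nondecreasing [tau] in the order in which the martingale runs; [Q] keeps
    the indices for which the crossing bound is applied. *)
Definition thresholds (R : realType) (m : nat) (tau : nat -> R) (Q : pred nat) : seq (R * nat) :=
  [seq (tau j, j) | j <- rev (iota 1 m) & Q j].

Lemma mem_thresholds (R : realType) m (tau : nat -> R) Q sj : sj \in thresholds m tau Q ->
  [/\ (0 < sj.2 <= m)%N, Q sj.2 & sj.1 = tau sj.2].
Proof.
move=> /mapP[j]; rewrite mem_filter mem_rev mem_iota add1n ltnS => /andP[Qj jm] ->.
by split.
Qed.

Lemma sorted_thresholds (R : realType) m (tau : nat -> R) Q :
  {homo tau : i j / (i <= j)%N >-> i <= j} ->
  sorted (fun x y : R * nat => y.1 <= x.1) (thresholds m tau Q).
Proof.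
move=> tau_nd; rewrite sorted_map /=.
apply: sorted_filter => [i j k /= ji kj|]; first exact: le_trans kj ji.
rewrite rev_sorted; apply: (sub_sorted _ (iota_sorted 1 m)) => i j /=; exact: tau_nd.
Qed.

Section CrossingBounds.
Context {d : measure_display} {T : measurableType d} {R : realType}.
Context (P : probability T R) {m : nat} (p : 'I_m -> T -> R) (H0 : {set 'I_m}).
Context (mp : forall i, measurable_fun setT (p i)).
Context (p01 : forall i t, 0 <= p i t <= 1).
Context (superunif : forall i, i \in H0 -> forall x : R,
     (P [set t | (p i t <= x)%R] <= (Num.max 0 (Num.min x 1))%:E)%E).
Context (indep : mutually_independent P H0 p).
Implicit Types (tau : nat -> R) (Q : pred nat).

(** The threshold crossed is the one indexed by the count [j] at [q] itself: since [q <= tau j], the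
    count at [tau j] is at least [j]. *)
Lemma thresholds_crosses tau Q t q : (0 < count_le p H0 q t)%N ->
  q <= tau (count_le p H0 q t) -> Q (count_le p H0 q t) ->
  crosses p H0 (thresholds m tau Q) t.
Proof.
move=> c0 qtau Qc; set j := count_le p H0 q t in c0 qtau Qc *.
apply/hasP; exists (tau j, j) => /=.
  apply: map_f; rewrite mem_filter Qc mem_rev mem_iota c0 add1n ltnS.
  by rewrite (leq_trans (max_card _)) ?card_ord.
apply: subset_leq_card; apply/fintype.subsetP => i; rewrite !inE => /andP[-> pq].
exact: le_trans qtau.
Qed.

Lemma Pr_dkw (e : R) : (0 < m)%N -> 0 <= e ->
  Pr P (crosses p H0 (thresholds m (fun j => j%:R / m%:R - e)
    (fun j => 0 < j%:R / m%:R - e :> R))) <= expR (- (2 * m%:R * e ^+ 2)).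
Proof.
move=> m0 e0; have m0' : 0 < m%:R :> R by rewrite ltr0n.
pose tau j : R := j%:R / m%:R - e; pose Q j := 0 < tau j.
rewrite -/(thresholds m tau Q).
have tau_nd : {homo tau : i j / (i <= j)%N >-> i <= j}.
  by move=> i j ij; rewrite /tau lerD2r ler_pM2r ?invr_gt0// ler_nat.
have tau_le j : (j <= m)%N -> tau j <= 1 - e.
  by move=> jm; rewrite /tau lerD2r ler_pdivrMr// mul1r ler_nat.
rewrite expRN -[leRHS]mul1r ler_pdivlMr ?expR_gt0//.
have [e1|e1] := ltP e 1; last first.
  (* For [e >= 1] every [tau j] is at most 0, so the list is empty and the requirement on [L] is
     vacuous, even with [c = 0]. *)
  have := @Pr_crosses_le _ _ _ P _ p H0 mp p01 superunif indep 0
    (expR (2 * m%:R * e ^+ 2)) (thresholds m tau Q) (lexx _) _ (sorted_thresholds _ _ tau_nd).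
  rewrite addr0 expr1n; apply => -[s j] /mem_thresholds[/= /andP[j0 jm] Qj _].
  by have := tau_le j jm; move: Qj; rewrite /Q; lra.
have e01 : 0 <= e < 1 by rewrite e0.
have c0 := dkw_c_ge0 e01; set c := dkw_c e in c0.
have c1 : 0 < 1 + c by rewrite ltr_pwDl.
rewrite -(ler_pM2r (exprn_gt0 m c1)) mul1r -[leLHS]mulrA.
apply: (@Pr_crosses_le _ _ _ P _ p H0 mp p01 superunif indep) => //; last first.
  exact: sorted_thresholds.
move=> [s j] /mem_thresholds[/= /andP[j0 jm] Qj sE]; rewrite (sE : s = tau j); split.
  by rewrite [0 < _]Qj /= (le_trans (tau_le j jm))// gerBl.
have t0 : 0 < tau j by [].
have ct0 : 0 < 1 + c / tau j by rewrite ltr_pwDl// divr_ge0// ltW.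
rewrite -[X in _ * X ^+ _]lnK ?posrE// -[X in _ <= X ^+ _]lnK ?posrE//.
rewrite -!expRM_natl -expRD ler_expR.
have -> : j%:R = m%:R * (tau j + e) by rewrite /tau subrK mulrC divfK// gt_eqF.
rewrite -[leRHS]mulrA [leLHS](_ : _ = m%:R * (ln (1 + c) + 2 * e ^+ 2)); last by ring.
by rewrite ler_pM2l//; exact: dkw_exponent.
Qed.

(** With [c = s (x - 1)] one has [1 + c / s = x], so [L = x ^ (m x s)] is admissible;
    [(1 + c) ^+ m <= expR (m c)] then leaves the exponent [m c - m x s ln x = - m s h(x)]. *)
Lemma Pr_linear_boundary (s x : R) : (0 < m)%N -> 0 < s -> 1 < x ->
  Pr P (crosses p H0 (thresholds m (fun k => k%:R / (m%:R * x))
    (fun k => s <= k%:R / (m%:R * x)))) <= expR (- (m%:R * s * h_fun x)).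
Proof.
move=> m0 s0 x1; have m0' : 0 < m%:R :> R by rewrite ltr0n.
have x0 : 0 < x by exact: lt_trans x1.
have mx0 : 0 < m%:R * x by rewrite mulr_gt0.
pose tau k : R := k%:R / (m%:R * x); pose Q k := s <= tau k.
rewrite -/(thresholds m tau Q).
have tau_nd : {homo tau : i j / (i <= j)%N >-> i <= j}.
  by move=> i j ij; rewrite /tau ler_pM2r ?invr_gt0// ler_nat.
have c0 : 0 <= s * (x - 1) by rewrite mulr_ge0 ?ltW// subr_gt0.
set c := s * (x - 1) in c0.
have : Pr P (crosses p H0 (thresholds m tau Q)) * expR (m%:R * x * (s * ln x)) <= (1 + c) ^+ m.
  apply: (@Pr_crosses_le _ _ _ P _ p H0 mp p01 superunif indep) => //; last first.
    exact: sorted_thresholds.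
  move=> [r k] /mem_thresholds[/= /andP[k0 km] Qk rE]; rewrite (rE : r = tau k).
  have t0 : 0 < tau k by exact: lt_le_trans Qk.
  split.
    rewrite t0 /= /tau ler_pdivrMr// mul1r (@le_trans _ _ m%:R) ?ler_nat//.
    by rewrite ler_peMr// ltW.
  have ct0 : 0 < 1 + c / tau k by rewrite ltr_pwDl// divr_ge0// ltW.
  rewrite -[X in _ <= X ^+ _]lnK ?posrE// -expRM_natl ler_expR.
  have -> : k%:R = m%:R * x * tau k by rewrite /tau mulrC divfK// gt_eqF.
  rewrite -[leRHS]mulrA ler_pM2l//.
  have {1}-> : x = 1 + c / s by rewrite /c; field; rewrite gt_eqF.
  exact: mul_ln1D_ndecr.
rewrite -ler_pdivlMr ?expR_gt0// => /le_trans; apply.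
rewrite ler_pdivrMr ?expR_gt0// -expRD.
have -> : - (m%:R * s * h_fun x) + m%:R * x * (s * ln x) = m%:R * c.
  by rewrite /h_fun /c; ring.
by rewrite expRM_natl lerXn2r ?nnegrE ?expR_ge0 ?addr_ge0// expR_ge1Dx.
Qed.

(** Take [c = y / m]. Bernoulli's inequality allows [L = 1 + y / a], and
    [(1 + c) ^+ m <= expR y <= 1 / (1 - y)] yields [Pc * (1 - y) <= a]; then [y] is made small. *)
Lemma Pr_simes (a : R) : (0 < m)%N -> 0 < a < 1 ->
  Pr P (crosses p H0 (thresholds m (fun k => a * k%:R / m%:R) xpredT)) <= a.
Proof.
move=> m0 /andP[a0 a1]; have m0' : 0 < m%:R :> R by rewrite ltr0n.
pose tau k : R := a * k%:R / m%:R; rewrite -/(thresholds m tau xpredT).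
have tau_nd : {homo tau : i j / (i <= j)%N >-> i <= j}.
  by move=> i j ij; rewrite /tau ler_pM2r ?invr_gt0// ler_pM2l// ler_nat.
set Pc := Pr P _.
have Pc_le (y : R) : 0 < y < 1 -> Pc * (1 - y) <= a.
  move=> /andP[y0 y1]; set c := y / m%:R.
  have c0 : 0 < c by rewrite divr_gt0.
  have hyp sj : sj \in thresholds m tau xpredT ->
      0 < sj.1 <= 1 /\ 1 + y / a <= (1 + c / sj.1) ^+ sj.2.
    case: sj => [r k] /mem_thresholds[/= /andP[k0 km] _ rE]; rewrite (rE : r = tau k).
    have k0' : 0 < k%:R :> R by rewrite ltr0n.
    have t0 : 0 < tau k by rewrite /tau divr_gt0// mulr_gt0.
    split.
      rewrite t0 /= /tau ler_pdivrMr// mul1r (@le_trans _ _ k%:R) ?ler_nat//.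
      by rewrite ger_pMl// ltW.
    have -> : y / a = k%:R * (c / tau k) by rewrite /c /tau; field; rewrite !gt_eqF.
    have : 0 <= c / tau k by rewrite divr_ge0// ltW.
    move: (c / tau k) => u u0; elim: (k) => [|n ih]; first by rewrite mul0r addr0 expr0.
    rewrite exprS (@le_trans _ _ ((1 + u) * (1 + n%:R * u)))//; last first.
      by rewrite ler_wpM2l// addr_ge0.
    rewrite -natr1; have : 0 <= n%:R * (u * u) by rewrite !mulr_ge0.
    lra.
  have := Pr_crosses mp p01 superunif indep (ltW c0) hyp (sorted_thresholds _ _ tau_nd).
  rewrite -/Pc addrAC subrr add0r => Pcy.
  have e1 : (1 + c) ^+ m <= (1 - y)^-1.
    apply: (@le_trans _ _ (expR y)).
      have -> : y = m%:R * c by rewrite /c mulrC divfK// gt_eqF.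
      by rewrite expRM_natl lerXn2r ?nnegrE ?expR_ge0 ?addr_ge0 ?expR_ge1Dx// ltW.
    rewrite -[leLHS]invrK lef_pV2 ?posrE ?invr_gt0 ?expR_gt0 ?subr_gt0//.
    by rewrite -expRN; exact: expR_ge1Dx.
  have := le_trans Pcy (lerB e1 (lexx 1)).
  have y1' : 0 < 1 - y by rewrite subr_gt0.
  have -> : (1 - y)^-1 - 1 = y / (1 - y) by field; rewrite gt_eqF.
  rewrite mulrCA ler_pM2l// ler_pdivrMr// => Pa.
  by rewrite -ler_pdivlMr// mulrC.
rewrite leNgt; apply/negP => aPc.
have Pc0 : 0 < Pc by exact: lt_trans aPc.
(* This [y] turns the bound into [(Pc + a) / 2 <= a], against [a < Pc]. *)
have y01 : 0 < (1 - a / Pc) / 2 < 1.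
  have : a / Pc < 1 by rewrite ltr_pdivrMr// mul1r.
  have : 0 < a / Pc by rewrite divr_gt0.
  by move=> ? ?; apply/andP; split; lra.
have := Pc_le _ y01.
have -> : Pc * (1 - (1 - a / Pc) / 2) = (Pc + a) / 2 by field; rewrite gt_eqF.
lra.
Qed.

End CrossingBounds.

(** * Joint error rate of the three families *)

Section MainBounds.
Context {d : measure_display} {T : measurableType d} {R : realType}.
Context (P : probability T R) {m : nat} (p : 'I_m -> T -> R) (H0 : {set 'I_m}).
Context (alpha : R) (sigma : T -> {perm 'I_m}).
Context (mp : forall i, measurable_fun setT (p i)).
Context (p01 : forall i t, 0 <= p i t <= 1).
Context (superunif : forall i, i \in H0 -> forall x : R,
     (P [set t | (p i t <= x)%R] <= (Num.max 0 (Num.min x 1))%:E)%E).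
Context (indep : mutually_independent P H0 p).
Context (alpha01 : 0 < alpha < 1).
Context (psorted : forall t (i j : 'I_m),
  (i <= j)%N -> p (sigma t i) t <= p (sigma t j) t).
Context (m_gt0 : (0 < m)%N).

(** The boundaries follow a separate rule at [q = 0], and this one point does not affect
    measurability. *)
Lemma measurable_unit_split (X A : set R) : measurable A ->
  (forall q, 0 < q <= 1 -> (X q <-> A q)) ->
  measurable [set q : R | 0 <= q <= 1 /\ X q].
Proof.
move=> mA XA.
have m01 : measurable (`]0, 1]%classic `&` A) by exact: measurableI.
have [X0|X0] := pselect (X 0).
  rewrite (_ : [set q | _] = (`]0, 1]%classic `&` A) `|` [set 0]).
    by apply: measurableU => //; exact: measurable_set1.
  apply/seteqP; split => q /=; rewrite in_itv/=.
    move=> [/andP[+ q1] Xq]; rewrite [0 <= q]le_eqVlt => /orP[/eqP <-|q0]; first by right.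
    by left; rewrite q0 q1; split => //; apply/XA; rewrite ?q0.
  move=> [[q01 /XA Aq]|->]; last by rewrite lexx ler01.
  by split; [have /andP[/ltW -> ->] := q01|exact: Aq].
rewrite (_ : [set q | _] = `]0, 1]%classic `&` A)//.
apply/seteqP; split => q /=; rewrite in_itv/=.
  move=> [/andP[+ q1] Xq]; rewrite [0 <= q]le_eqVlt => /orP[/eqP q0|q0].
    by rewrite -q0 in Xq.
  by rewrite q0 q1; split => //; apply/XA; rewrite ?q0.
by move=> [q01 /XA Aq]; split; [have /andP[/ltW -> ->] := q01|exact: Aq].
Qed.

Let m0 : 0 < m%:R :> R. Proof. by rewrite ltr0n. Qed.
Let a0 : 0 < alpha. Proof. by case/andP: alpha01. Qed.
Let a1 : alpha < 1. Proof. by case/andP: alpha01. Qed.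

Lemma JER_zeta1 : (JER P H0 (fun t => Rfam (sigma t))
  (fun t k => zeta1 m alpha (p (sigma t k) t) k.+1) <= alpha%:E)%E.
Proof.
set S := Num.sqrt (m%:R / 2 * ln (1 / alpha)).
pose Z (q : R) := if 0 < q then Num.floor (m%:R * q + S) else 0.
have S0 : 0 <= S by exact: sqrtr_ge0.
have la0 : 0 < ln (1 / alpha) by rewrite ln_gt0// div1r invf_gt1.
(* The deviation at which the bound of [Pr_dkw] equals [alpha]. *)
pose e := S / m%:R; have e0 : 0 <= e by rewrite divr_ge0// ltW.
have Sm : S = m%:R * e by rewrite /e mulrC divfK// gt_eqF.
have eE : expR (- (2 * m%:R * e ^+ 2)) = alpha.
  have -> : - (2 * m%:R * e ^+ 2) = - ln (1 / alpha).
    rewrite /e expr_div_n sqr_sqrtr; last by rewrite mulr_ge0 ?divr_ge0 ?ltW.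
    by field; rewrite gt_eqF.
  by rewrite div1r lnV ?posrE// opprK lnK.
pose D := crosses p H0 (thresholds m (fun j => j%:R / m%:R - e)
  (fun j => 0 < j%:R / m%:R - e)).
apply: (@JER_le _ _ _ P _ p H0 sigma mp p01 superunif psorted Z _ D) => //.
- move=> n; apply: (@measurable_unit_split _ [set q | m%:R * q + S < n%:R]).
    apply: measurable_ltf => //.
    by apply: measurable_funD => //; apply: measurable_funM.
  move=> q /andP[q0 _] /=; rewrite /Z q0 floor_lt_int; exact.
- by rewrite /Z ltxx.
- exact: (measurable_crosses mp).
- by rewrite -[leRHS]eE; exact: Pr_dkw.
move=> t q /andP[q0 q1]; rewrite /Z q0 floor_lt_int => qS.
set k := count_le p H0 q t in qS *.
have k0 : (0 < k)%N.
  rewrite -(ltr0n R); apply: le_lt_trans qS.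
  by rewrite addr_ge0// mulr_ge0// ltW.
have qtau : q < k%:R / m%:R - e.
  rewrite ltrBrDr ltr_pdivlMr// mulrC mulrDr -Sm; exact: qS.
apply: (thresholds_crosses (tau := fun j => j%:R / m%:R - e)
  (Q := fun j => 0 < j%:R / m%:R - e) k0); first exact: ltW.
exact: lt_trans qtau.
Qed.

Lemma JER_zeta3 : (JER P H0 (fun t => Rfam (sigma t))
  (fun t k => zeta3 m alpha (p (sigma t k) t) k.+1) <= alpha%:E)%E.
Proof.
pose Z (q : R) := if 0 < q then Num.ceil (m%:R * q / alpha) - 1 else 0.
(* Ceiling minus one turns the strict error condition into a non-strict one, so that
   [q = alpha * n / m] counts as a crossing. *)
have ZE q (n : nat) : 0 < q -> (Z q < n%:Z) = (m%:R * q / alpha <= n%:R).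
  by move=> q0; rewrite /Z q0 ltrBlDr ltzD1 ceil_le_int.
pose D := crosses p H0 (thresholds m (fun k => alpha * k%:R / m%:R) xpredT).
apply: (@JER_le _ _ _ P _ p H0 sigma mp p01 superunif psorted Z _ D) => //.
- move=> n; apply: (@measurable_unit_split _ [set q | m%:R * q / alpha <= n%:R]).
    apply: measurable_lef => //.
    by apply: measurable_funM => //; apply: measurable_funM.
  by move=> q /andP[q0 _] /=; rewrite ZE.
- by rewrite /Z ltxx.
- exact: (measurable_crosses mp).
- exact: Pr_simes.
move=> t q /andP[q0 q1]; rewrite ZE// => qk.
set k := count_le p H0 q t in qk *.
have k0 : (0 < k)%N.
  rewrite -(ltr0n R); apply: lt_le_trans qk.
  by rewrite divr_gt0// mulr_gt0.
apply: (thresholds_crosses (tau := fun k => alpha * k%:R / m%:R) (Q := xpredT) k0) => //.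
by rewrite /= ler_pdivlMr// [alpha * _]mulrC -ler_pdivrMr// [q * _]mulrC.
Qed.

(** [expR (- lk j)] is the share of [alpha] granted to the dyadic block [j]; these shares sum to at
    most [alpha]. *)
Let lk (j : nat) : R := ln (@kappa R * j.+1%:R ^+ 2 / alpha).

Let lk_gt0 j : 0 < lk j.
Proof.
rewrite ln_gt0// ltr_pdivlMr// mul1r (lt_le_trans a1)//.
by rewrite mulr_ege1// ?kappa_ge1// exprn_ege1// ler1n.
Qed.

Let zarg (q : R) : R := 2 * ln (@kappa R / alpha) + 4 * ln (1 + log2 (1 / q)).

Let kappa_gt0 : 0 < @kappa R.
Proof. exact: lt_le_trans (@kappa_ge1 R). Qed.

Let ln2_gt0 : 0 < ln 2 :> R. Proof. by rewrite ln_gt0// ltr1n. Qed.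

Let zargE q : 0 < q -> zarg q = 2 * ln (@kappa R / alpha) + 4 * ln (1 - ln q / ln 2).
Proof. by move=> q0; rewrite /zarg /log2 div1r lnV ?posrE// mulNr. Qed.

Let zarg_gt0 q : 0 < q <= 1 -> 0 < zarg q.
Proof.
move=> /andP[q0 q1]; rewrite zargE// ltr_pwDl//.
  rewrite mulr_gt0// ln_gt0// ltr_pdivlMr// mul1r (lt_le_trans a1)//.
  exact: kappa_ge1.
rewrite mulr_ge0// ln_ge0// lerDl oppr_ge0 mulr_le0_ge0 ?ln_le0//.
by rewrite invr_ge0 ltW.
Qed.

Lemma dyadic_block (q : R) : 0 < q <= 1 ->
  exists j : nat, (2 ^+ j.+1)^-1 <= q <= (2 ^+ j)^-1.
Proof.
move=> /andP[q0 q1].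
have ex : exists n : nat, (2 ^+ n)^-1 <= q.
  exists (Num.truncn q^-1).+1; rewrite invf_ple ?posrE ?exprn_gt0//.
  apply: (@le_trans _ _ (Num.truncn q^-1).+1%:R); first by rewrite ltW// truncnS_gt.
  by rewrite -natrX ler_nat ltnW// ltn_expl.
case: (ex_minnP ex) => -[|n] qn nmin.
  exists 0%N; rewrite expr0 invr1 q1 andbT (le_trans _ qn)// expr0 invr1.
  by rewrite invf_le1// expr1 ler1n.
exists n; rewrite qn /= leNgt; apply/negP => /ltW/nmin.
by rewrite ltnn.
Qed.

(* The factor [2] pays for replacing [q], in the block [2^-(j+1), 2^-j], by [2^-(j+1)]. *)
Lemma zarg_ge j q : 0 < q <= (2 ^+ j)^-1 -> 2 * lk j <= zarg q.
Proof.
move=> /andP[q0 qj]; rewrite zargE//.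
have lq : ln q <= - (j%:R * ln 2).
  have -> : - (j%:R * ln 2) = ln (2 ^+ j)^-1 :> R.
    by rewrite lnV ?posrE ?exprn_gt0// lnXn// mulr_natl.
  by rewrite ler_ln ?posrE ?invr_gt0 ?exprn_gt0.
have lj : j.+1%:R <= 1 - ln q / ln 2.
  rewrite -natr1 addrC lerD2l -mulNr ler_pdivlMr//; move: lq; lra.
have j0 : 0 < j.+1%:R :> R by rewrite ltr0n.
have : ln j.+1%:R <= ln (1 - ln q / ln 2).
  by rewrite ler_ln ?posrE//; exact: lt_le_trans lj.
have -> : lk j = ln (@kappa R / alpha) + 2 * ln j.+1%:R.
  have ka0 : 0 < @kappa R / alpha by apply: divr_gt0.
  rewrite /lk mulrAC [LHS]lnM ?posrE ?exprn_gt0//.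
  by rewrite [ln (_ ^+ _)]lnXn// mulr_natl.
by move=> lnj; rewrite mulrDr lerD2l mulrA -natrM ler_pM2l.
Qed.

Let Z2 (q : R) : int :=
  if q == 0 then 0 else Num.floor (m%:R * q * h_inv (zarg q / (m%:R * q))).

(** Removes [h_inv]: apply [h_fun] to both sides. The conjunct [m q < n] places [n / (m q)] on the
    branch [(1, +oo)], where [h_fun] is increasing. *)
Lemma Z2_lt q (n : nat) : 0 < q <= 1 ->
  (Z2 q < n%:Z) <-> (m%:R * q < n%:R /\ zarg q / (m%:R * q) < h_fun (n%:R / (m%:R * q))).
Proof.
move=> q01; have /andP[q0 q1] := q01.
have mq0 : 0 < m%:R * q by rewrite mulr_gt0.
have t0 : 0 < zarg q / (m%:R * q) by rewrite divr_gt0// zarg_gt0.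
have [y1 hy] := h_invP t0; set y := h_inv _ in y1 hy *.
rewrite /Z2 gt_eqF// floor_lt_int -/y mulrC -ltr_pdivlMr//.
have -> : (m%:R * q < n%:R) = (1 < n%:R / (m%:R * q)) by rewrite ltr_pdivlMr ?mul1r.
rewrite -[n%:~R]/(n%:R : R).
move: (n%:R / (m%:R * q)) => x; split => [yx|[x1 hx]].
  split; first exact: lt_trans yx.
  by rewrite -hy h_fun_lt// ltW.
rewrite ltNge; apply/negP => xy.
have := h_fun_le (ltW x1) xy; rewrite hy => /(lt_le_trans hx).
by rewrite ltxx.
Qed.

Lemma measurable_Z2 (n : nat) : measurable [set q : R | 0 <= q <= 1 /\ Z2 q < n%:Z].
Proof.
pose u (q : R) := 2 * ln (@kappa R / alpha) + 4 * ln (1 - ln q / ln 2).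
(* For [q > 0], [u] is [zarg], and [v] is [m q h(n / (m q))] with the logarithm expanded. *)
pose v (q : R) := n%:R * (ln n%:R - ln m%:R - ln q - 1) + m%:R * q.
apply: (@measurable_unit_split _ ([set q | m%:R * q < n%:R] `&` [set q | u q < v q])).
  apply: measurableI; apply: measurable_ltf => //.
    apply: measurable_funD => //; apply: measurable_funM => //.
    apply: measurableT_comp => //; apply: measurable_funB => //.
    by apply: measurable_funM => //; exact: measurable_ln.
  apply: measurable_funD => //.
  apply: measurable_funM => //; apply: measurable_funB => //.
  by apply: measurable_funB => //; exact: measurable_ln.
move=> q q01; have /andP[q0 q1] := q01; apply: (iff_trans (Z2_lt n q01)).
have mq0 : 0 < m%:R * q by rewrite mulr_gt0.
suff uv : m%:R * q < n%:R -> (zarg q / (m%:R * q) < h_fun (n%:R / (m%:R * q))) = (u q < v q).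
  by split => -[mqn]; [rewrite uv|rewrite /= -uv].
move=> mqn; have n0 : 0 < n%:R :> R by exact: lt_trans mqn.
rewrite ltr_pdivrMr// zargE//; congr (_ < _).
rewrite /h_fun /v ln_div ?posrE// lnM ?posrE//.
by field; rewrite !gt_eqF.
Qed.

Lemma JER_zeta2 : (JER P H0 (fun t => Rfam (sigma t))
  (fun t k => zeta2 m alpha (p (sigma t k) t) k.+1) <= alpha%:E)%E.
Proof.
pose s (j : nat) : R := (2 ^+ j.+1)^-1.
have s0 j : 0 < s j by rewrite invr_gt0 exprn_gt0.
(* The slope for which the bound of [Pr_linear_boundary] from [s j] on is exactly
   [expR (- lk j)]. *)
pose x j := h_inv (lk j / (m%:R * s j)).
have x_h j : 1 < x j /\ h_fun (x j) = lk j / (m%:R * s j).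
  by apply: h_invP; rewrite divr_gt0// mulr_gt0.
pose D j := crosses p H0 (thresholds m (fun k => k%:R / (m%:R * x j))
    (fun k => s j <= k%:R / (m%:R * x j))).
have mD j : measurable (D j) by exact: measurable_crosses.
have PD j : Pr P (D j) <= alpha / kappa * (j.+1%:R ^+ 2)^-1.
  have [x1 hx] := x_h j.
  apply: (le_trans (Pr_linear_boundary mp p01 superunif indep m_gt0 (s0 j) x1)).
  rewrite hx mulrC divfK; last by rewrite gt_eqF// mulr_gt0.
  rewrite /lk expRN lnK; last first.
    by rewrite posrE; apply: divr_gt0 => //; apply: mulr_gt0 => //; rewrite exprn_gt0.
  have j0 : j.+1%:R != 0 :> R by rewrite pnatr_eq0.
  rewrite invf_div invfM mulrA.
  by rewrite lexx.
have mU : measurable (\bigcup_j D j) by exact: bigcupT_measurable.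
apply: (@JER_le _ _ _ P _ p H0 sigma mp p01 superunif psorted Z2 _ (\bigcup_j D j)).
- move=> q k q01; rewrite /zeta2 /Z2; case: ifPn => // _.
  by rewrite min_l.
- exact: measurable_Z2.
- by rewrite /Z2 eqxx.
- exact: mU.
- rewrite -lee_fin -PrE//.
  apply: (le_trans (generalized_Boole_inequality P mD mU)).
  apply: lime_le; first by apply: is_cvg_nneseries => *; exact: measure_ge0.
  apply: nearW => n.
  rewrite (eq_bigr (fun j => (Pr P (D j))%:E)) => [|j _]; last exact: PrE.
  rewrite sumEFin lee_fin big_mkord.
  apply: (@le_trans _ _ (\sum_(j < n) alpha / kappa * (j.+1%:R ^+ 2)^-1)).
    by apply: ler_sum => j _; exact: PD.
  rewrite -mulr_sumr mulrAC ler_pdivrMr// ler_pM2l//.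
  exact: sum_inv_sqr_le.
move=> t q q01 /(Z2_lt _ q01).
set k := count_le p H0 q t => -[mqk hk]; have /andP[q0 q1] := q01.
have mq0 : 0 < m%:R * q by rewrite mulr_gt0.
have k0 : (0 < k)%N by rewrite -(ltr0n R); exact: lt_trans mqk.
have [j /andP[sq qs]] := dyadic_block q01; exists j => //.
have [x1 hx] := x_h j.
have x0 : 0 < x j by exact: lt_trans x1.
(* Otherwise [h(k / (m q)) <= h(x j) = lk j / (m s_j) <= 2 lk j / (m q) <= zarg q / (m q)], using
   [q <= 2 s_j]; this contradicts the error condition. *)
have xk : x j < k%:R / (m%:R * q).
  rewrite ltNge; apply/negP => kx.
  have k1 : 1 <= k%:R / (m%:R * q) by rewrite ler_pdivlMr// mul1r ltW.
  have := lt_le_trans hk (h_fun_le k1 kx); rewrite hx ltNge => /negP; apply.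
  apply: (@le_trans _ _ (2 * lk j / (m%:R * q))); last first.
    by rewrite ler_pM2r ?invr_gt0// zarg_ge// q0.
  have qs2 : q <= 2 * s j.
    apply: (le_trans qs); rewrite /s exprS invfM mulrA divff ?mul1r//.
  rewrite ler_pdivlMr// mulrAC ler_pdivrMr ?mulr_gt0//.
  have := ler_wpM2l (mulr_ge0 (ltW (lk_gt0 j)) (ltW m0)) qs2; lra.
have qtau : q <= k%:R / (m%:R * x j).
  rewrite ltW// ltr_pdivlMr ?mulr_gt0//; move: xk; rewrite ltr_pdivlMr//.
  by rewrite mulrCA mulrA [m%:R * _]mulrC -mulrA [q * _]mulrC mulrA.
apply: (thresholds_crosses (tau := fun k => k%:R / (m%:R * x j))
  (Q := fun k => s j <= k%:R / (m%:R * x j)) k0) => //.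
exact: le_trans qtau.
Qed.

End MainBounds.

Theorem mainTheorem3 (d : measure_display) (T : measurableType d) (R : realType)
  (P : probability T R) (m : nat) (p : 'I_m -> T -> R) (H0 : {set 'I_m})
  (alpha : R) (sigma : T -> {perm 'I_m}) :
  (forall i, measurable_fun setT (p i)) ->
  (forall i t, 0 <= p i t <= 1) ->
  (* (A1) *)
  (forall i, i \in H0 -> forall x : R,
     P [set t | (p i t <= x)%R] <= (Num.max 0 (Num.min x 1))%:E)%E ->
  (* (A2) *)
  mutually_independent P H0 p ->
  0 < alpha < 1 ->
  (forall t (i j : 'I_m), (i <= j)%N -> p (sigma t i) t <= p (sigma t j) t) ->
  [/\ (JER P H0 (fun t => Rfam (sigma t))
         (fun t k => zeta1 m alpha (p (sigma t k) t) k.+1) <= alpha%:E)%E,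
      (JER P H0 (fun t => Rfam (sigma t))
         (fun t k => zeta2 m alpha (p (sigma t k) t) k.+1) <= alpha%:E)%E &
      (JER P H0 (fun t => Rfam (sigma t))
         (fun t k => zeta3 m alpha (p (sigma t k) t) k.+1) <= alpha%:E)%E].
Proof.
move=> mp p01 superunif indep alpha01 psorted.
have [m0|m_gt0] := posnP m.
  have JER0 (zeta : T -> 'I_m -> int) :
      (JER P H0 (fun t => Rfam (sigma t)) zeta <= alpha%:E)%E.
    rewrite /JER (_ : [set t | _] = set0); last first.
      by rewrite -subset0 => t [k _]; have := leq_trans (ltn_ord k) (eq_leq m0).
    by rewrite measure0 lee_fin; case/andP: alpha01 => /ltW.
  by split; exact: JER0.
split.
- exact: JER_zeta1.
- exact: JER_zeta2.
- exact: JER_zeta3.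
Qed.
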